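(* Let $K=(\mathcal T,\mathcal A)$ be an $\mathcal{ALC}^\Omega$ knowledge base and let $K^T=(\mathcal T^T,\mathcal A^T)$ be its translation into $\mathcal{ALCOI}$. The translation is complete, that is, for any query $F$ (over the language of $K$), with translation $F^T$: $$K\models_{\mathcal{ALC}^\Omega}F\ \Longrightarrow\ K^T\models_{\mathcal{ALCOI}}F^T .$$
   Context: **The theory $\Omega$.** First-order theory with binary relation symbols $\in,\subseteq$, binary function symbols $\cup,\backslash$ and a unary function symbol $\mathit{Pow}$, with axioms (universally closed): (1) $x\in y\cup z\leftrightarrow x\in y\vee x\in z$; (2) $x\in y\backslash z\leftrightarrow x\in y\wedge x\notin z$; (3) $x\subseteq y\leftrightarrow\forall z(z\in x\to z\in y)$; (4) $x\in \mathit{Pow}(y)\leftrightarrow x\subseteq y$. No extensionality or well-foundedness is assumed. An $\Omega$-model is a first-order structure with universe $\mathcal U$ satisfying these axioms; it is a model over a set of atoms $\mathbb A=\{\mathbf a_1,\mathbf a_2,\dots\}$ if $\mathbb A\subseteq\mathcal U$, where atoms are pairwise distinct elements having no members (distinct copies of the empty set). An element $x$ is a transitive set if $(\forall y\in x)(y\subseteq x)$. **$\mathcal{ALC}^\Omega$.** Let $N_C,N_R,N_I$ be disjoint sets of concept, role and individual names. Concepts: $A\in N_C$, $\top$, $\bot$, and, for concepts $C,D$ and $R\in N_R$: $C\sqcap D$, $C\sqcup D$, $\neg C$, $C\backslash D$, $\mathtt{Pow}(C)$, $\forall R.C$, $\exists R.C$. A knowledge base (KB) is $K=(\mathcal T,\mathcal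 A)$, with $\mathcal T$ (TBox) a (finite) set of inclusions $C\sqsubseteq D$, and $\mathcal A$ (ABox) a (finite) set of assertions $C(a)$, $R(a,b)$ ($a,b\in N_I$), concept membership axioms $C\in D$ and role membership axioms $(C,D)\in R$. An interpretation over atoms $\mathbb A$ is $I=\langle\Delta,\cdot^I\rangle$ where $\Delta$ is a non-empty transitive set in the universe $\mathcal U$ of an $\Omega$-model over $\mathbb A$; $A^I\subseteq\Delta$ for $A\in N_C$; $R^I\subseteq\Delta\times\Delta$ for $R\in N_R$; $a^I\in\mathbb A\cap\Delta$ for $a\in N_I$. Extension to complex concepts: $\top^I=\Delta$, $\bot^I=\emptyset$, $(\neg C)^I=\Delta\backslash C^I$, $(C\sqcap D)^I=C^I\cap D^I$, $(C\sqcup D)^I=C^I\cup D^I$, $(C\backslash D)^I=C^I\backslash D^I$, $(\mathtt{Pow}(C))^I=\mathit{Pow}(C^I)\cap\Delta$, $(\forall R.C)^I=\{x\in\Delta\mid\forall y((x,y)\in R^I\to y\in C^I)\}$, $(\exists R.C)^I=\{x\in\Delta\mid\exists y((x,y)\in R^I\wedge y\in C^I)\}$. $I$ satisfies $C\sqsubseteq D$ iff $C^I\subseteq D^I$; $C(a)$ iff $a^I\in C^I$; $R(a,b)$ iff $(a^I,b^I)\in R^I$; $C\in D$ iff $C^I\in D^I$; $(C,D)\in R$ iff $(C^I,D^I)\in R^I$. $I$ is a model of $K$ if it satisfies all elements of $\mathcal T$ and $\mathcal A$. $K\models_{\mathcal{ALC}^\Omega}F$ means every model of $K$ satisfies $F$.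 **$\mathcal{ALCOI}$.** The standard description logic $\mathcal{ALC}$ (usual set-theoretic semantics over arbitrary non-empty domains) extended with inverse roles $R^-$ (where $(x,y)\in(R^-)^I$ iff $(y,x)\in R^I$) and nominals $\{a\}$ (where $(\{a\})^I=\{a^I\}$). $C\equiv D$ abbreviates $C\sqsubseteq D$ and $D\sqsubseteq C$. Entailment $\models_{\mathcal{ALCOI}}$ is truth in all models. **Translation.** Let $e$ be a new role name. For an $\mathcal{ALC}^\Omega$ concept $C$, $C^T$ is obtained by recursively replacing each subconcept $\mathtt{Pow}(D)$ by $\forall e.D^T$; $T$ commutes with all other constructors (with $C\backslash D$ read as $C\sqcap\neg D$), and $B^T=B$ for concept names $B$. For each concept $C$ occurring as an instance in a membership axiom of $K$ or of the query (i.e. $C$ in $C\in D$; $C$ and $D$ in $(C,D)\in R$) introduce a new individual name $e_C$. $\mathcal T^T$ consists of $C^T\sqsubseteq D^T$ for each $C\sqsubseteq D\in\mathcal T$, and $C^T\equiv\exists e^-.\{e_C\}$ for each such new name $e_C$. $\mathcal A^T$ consists of: $D^T(e_C)$ for each $C\in D$ in $\mathcal A$; $R(e_C,e_D)$ for each $(C,D)\in R$ in $\mathcal A$; $D^T(a)$ for each $D(a)$ in $\mathcal A$; $R(a,b)$ for each $R(a,b)$ in $\mathcal A$; and $(\neg\exists e.\top)(a)$ for each (original) individual name $a\in N_I$. A query $F$ has the form $C\sqsubseteq D$, $C(a)$ or $C\in D$, where all individual, concept and role names occurring in $F$ occur in $K$. $F^T$ is, respectively, $C^T\sqsubseteq D^T$,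 $C^T(a)$, $D^T(e_C)$.
   Formalization: The clauses for compound concepts fix only the members of C^I, which may be any element of the universe with those members; with literal equalities such as (¬C)^I = Δ\C^I the claim fails (¬A ∈ B would entail (⊤\A) ∈ B, but the translation does not). *)

(* Defs.v *)
From Stdlib Require Import List.

Set Implicit Arguments.
Unset Strict Implicit.
Unset Printing Implicit Defensive.

(* [atom] enumerates the atoms a_1, a_2, ...  Neither extensionality nor
   well-foundedness is required: distinct elements of the universe may have
   the same members, as the atoms do. *)
Record omega_model : Type := OmegaModel {
  univ :> Type;
  mem : univ -> univ -> Prop;
  subs : univ -> univ -> Prop;
  cup : univ -> univ -> univ;
  setminus : univ -> univ -> univ;
  Pow : univ -> univ;
  cup_ax : forall x y z, mem x (cup y z) <-> mem x y \/ mem x z;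
  setminus_ax : forall x y z, mem x (setminus y z) <-> mem x y /\ ~ mem x z;
  subs_ax : forall x y, subs x y <-> (forall z, mem z x -> mem z y);
  Pow_ax : forall x y, mem x (Pow y) <-> subs x y;
  atom : nat -> univ;
  atom_inj : forall m n, atom m = atom n -> m = n;
  atom_empty : forall n x, ~ mem x (atom n)
}.

Arguments mem {_} x y.
Arguments subs {_} x y.
Arguments cup {_} x y.
Arguments setminus {_} x y.
Arguments Pow {_} y.
Arguments atom {_} n.

Definition transitive_set (M : omega_model) (x : M) : Prop :=
  forall y, mem y x -> subs y x.

Inductive inclusion (X : Type) : Type := Incl (C D : X).

Inductive concept (NC NR : Type) : Type :=
| CName (A : NC)
| CTop
| CBot
| CAnd (C D : concept NC NR)
| COr (C D : concept NC NR)
| CNot (C : concept NC NR)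
| CDiff (C D : concept NC NR)
| CPow (C : concept NC NR)
| CAll (R : NR) (C : concept NC NR)
| CEx (R : NR) (C : concept NC NR).

Arguments CName {NC NR} A.
Arguments CTop {NC NR}.
Arguments CBot {NC NR}.

Inductive assertion (NC NR NI : Type) : Type :=
| AInst (C : concept NC NR) (a : NI)
| ARole (R : NR) (a b : NI)
| AMem (C D : concept NC NR)                 (* C \in D *)
| ARoleMem (C D : concept NC NR) (R : NR).   (* (C, D) \in R *)

Arguments AInst {NC NR NI} C a.
Arguments ARole {NC NR NI} R a b.
Arguments AMem {NC NR NI} C D.
Arguments ARoleMem {NC NR NI} C D R.

Record kb (NC NR NI : Type) : Type := KB {
  tbox : list (inclusion (concept NC NR));
  abox : list (assertion NC NR NI)
}.

Inductive query (NC NR NI : Type) : Type :=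
| QIncl (C D : concept NC NR)
| QInst (C : concept NC NR) (a : NI)
| QMem (C D : concept NC NR).                (* C \in D *)

Arguments QIncl {NC NR NI} C D.
Arguments QInst {NC NR NI} C a.
Arguments QMem {NC NR NI} C D.

Inductive name (NC NR NI : Type) : Type :=
| NConcept (A : NC)
| NRole (R : NR)
| NInd (a : NI).

Arguments NConcept {NC NR NI} A.
Arguments NRole {NC NR NI} R.
Arguments NInd {NC NR NI} a.

Fixpoint in_concept (NC NR NI : Type) (s : name NC NR NI)
    (C : concept NC NR) : Prop :=
  match C with
  | CName A => s = NConcept A
  | CTop | CBot => False
  | CAnd C D | COr C D | CDiff C D => in_concept s C \/ in_concept s D
  | CNot C | CPow C => in_concept s C
  | CAll R C | CEx R C => s = NRole R \/ in_concept s C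
  end.

Definition in_inclusion (NC NR NI : Type) (s : name NC NR NI)
    (i : inclusion (concept NC NR)) : Prop :=
  match i with Incl C D => in_concept s C \/ in_concept s D end.

Definition in_assertion (NC NR NI : Type) (s : name NC NR NI)
    (f : assertion NC NR NI) : Prop :=
  match f with
  | AInst C a => in_concept s C \/ s = NInd a
  | ARole R a b => s = NRole R \/ s = NInd a \/ s = NInd b
  | AMem C D => in_concept s C \/ in_concept s D
  | ARoleMem C D R => in_concept s C \/ in_concept s D \/ s = NRole R
  end.

Definition in_kb (NC NR NI : Type) (s : name NC NR NI)
    (K : kb NC NR NI) : Prop :=
  (exists i, In i (tbox K) /\ in_inclusion s i) \/
  (exists f, In f (abox K) /\ in_assertion s f).

Definition in_query (NC NR NI : Type) (s : name NC NR NI)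
    (F : query NC NR NI) : Prop :=
  match F with
  | QIncl C D => in_concept s C \/ in_concept s D
  | QInst C a => in_concept s C \/ s = NInd a
  | QMem C D => in_concept s C \/ in_concept s D
  end.

Definition query_over (NC NR NI : Type) (K : kb NC NR NI)
    (F : query NC NR NI) : Prop :=
  forall s, in_query s F -> in_kb s K.

Record interp (NC NR NI : Type) : Type := Interp {
  omod :> omega_model;
  dom : omod;
  dom_nonempty : exists x, mem x dom;
  dom_transitive : transitive_set dom;
  cname : NC -> omod;
  cname_dom : forall A, subs (cname A) dom;
  role : NR -> omod -> omod -> Prop;
  role_dom : forall R x y, role R x y -> mem x dom /\ mem y dom;
  ind : NI -> omod;
  ind_atom : forall a, (exists n, ind a = atom n) /\ mem (ind a) dom
}.

(* [ext] maps every concept C to the element C^I of the universe.  Omega has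
   neither comprehension nor extensionality, so a clause such as
   (forall R.C)^I = {x in Delta | ...} does not define C^I as a term of the
   theory; the clauses for compound concepts fix the members of C^I, and which
   of the coextensive elements of the universe is C^I is part of the
   interpretation. *)
Record is_extension (NC NR NI : Type) (I : interp NC NR NI)
    (ext : concept NC NR -> I) : Prop := IsExtension {
  ext_name : forall A, ext (CName A) = cname I A;
  ext_top : ext CTop = dom I;
  ext_bot : forall x, ~ mem x (ext CBot);
  ext_and : forall C D x,
    mem x (ext (CAnd C D)) <-> mem x (ext C) /\ mem x (ext D);
  ext_or : forall C D x,
    mem x (ext (COr C D)) <-> mem x (cup (ext C) (ext D));
  ext_not : forall C x,
    mem x (ext (CNot C)) <-> mem x (setminus (dom I) (ext C));
  ext_diff : forall C D x,
    mem x (ext (CDiff C D)) <-> mem x (setminus (ext C) (ext D));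
  ext_pow : forall C x,
    mem x (ext (CPow C)) <-> mem x (Pow (ext C)) /\ mem x (dom I);
  ext_all : forall R C x,
    mem x (ext (CAll R C)) <->
    mem x (dom I) /\ (forall y, role R x y -> mem y (ext C));
  ext_ex : forall R C x,
    mem x (ext (CEx R C)) <->
    mem x (dom I) /\ (exists y, role R x y /\ mem y (ext C))
}.

Definition sat_inclusion (NC NR NI : Type) (I : interp NC NR NI)
    (ext : concept NC NR -> I) (i : inclusion (concept NC NR)) : Prop :=
  match i with Incl C D => subs (ext C) (ext D) end.

Definition sat_assertion (NC NR NI : Type) (I : interp NC NR NI)
    (ext : concept NC NR -> I) (f : assertion NC NR NI) : Prop :=
  match f with
  | AInst C a => mem (ind I a) (ext C)
  | ARole R a b => role R (ind I a) (ind I b)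
  | AMem C D => mem (ext C) (ext D)
  | ARoleMem C D R => role R (ext C) (ext D)
  end.

Definition sat_query (NC NR NI : Type) (I : interp NC NR NI)
    (ext : concept NC NR -> I) (F : query NC NR NI) : Prop :=
  match F with
  | QIncl C D => subs (ext C) (ext D)
  | QInst C a => mem (ind I a) (ext C)
  | QMem C D => mem (ext C) (ext D)
  end.

Definition is_model (NC NR NI : Type) (I : interp NC NR NI)
    (ext : concept NC NR -> I) (K : kb NC NR NI) : Prop :=
  (forall i, In i (tbox K) -> sat_inclusion ext i) /\
  (forall f, In f (abox K) -> sat_assertion ext f).

Definition entails (NC NR NI : Type) (K : kb NC NR NI)
    (F : query NC NR NI) : Prop :=
  forall (I : interp NC NR NI) (ext : concept NC NR -> I),
    is_extension ext -> is_model ext K -> sat_query ext F.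

Inductive orole (NR : Type) : Type :=
| ORole (R : NR)
| OInv (R : NR).

Inductive oconcept (NC NR NI : Type) : Type :=
| OName (A : NC)
| OTop
| OBot
| OAnd (C D : oconcept NC NR NI)
| OOr (C D : oconcept NC NR NI)
| ONot (C : oconcept NC NR NI)
| OAll (r : orole NR) (C : oconcept NC NR NI)
| OEx (r : orole NR) (C : oconcept NC NR NI)
| ONominal (a : NI).

Arguments OName {NC NR NI} A.
Arguments OTop {NC NR NI}.
Arguments OBot {NC NR NI}.
Arguments ONominal {NC NR NI} a.

Inductive oassertion (NC NR NI : Type) : Type :=
| OInst (C : oconcept NC NR NI) (a : NI)
| ORel (R : NR) (a b : NI).

Arguments OInst {NC NR NI} C a.
Arguments ORel {NC NR NI} R a b.

(* The boxes are sets, possibly infinite: the translation of a finite knowledge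
   base contains one assertion for every individual name. *)
Record okb (NC NR NI : Type) : Type := OKB {
  otbox : inclusion (oconcept NC NR NI) -> Prop;
  oabox : oassertion NC NR NI -> Prop
}.

Inductive oquery (NC NR NI : Type) : Type :=
| OQIncl (i : inclusion (oconcept NC NR NI))
| OQAssert (f : oassertion NC NR NI).

Arguments OQIncl {NC NR NI} i.
Arguments OQAssert {NC NR NI} f.

Record ointerp (NC NR NI : Type) : Type := OInterp {
  odom : Type;
  odom_nonempty : inhabited odom;
  ocname : NC -> odom -> Prop;
  orname : NR -> odom -> odom -> Prop;
  oind : NI -> odom
}.

Definition orole_ext (NC NR NI : Type) (I : ointerp NC NR NI)
    (r : orole NR) (x y : odom I) : Prop :=
  match r with
  | ORole R => orname R x y
  | OInv R => orname R y x
  end.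

Fixpoint oext (NC NR NI : Type) (I : ointerp NC NR NI)
    (C : oconcept NC NR NI) (x : odom I) : Prop :=
  match C with
  | OName A => ocname A x
  | OTop => True
  | OBot => False
  | OAnd C D => oext C x /\ oext D x
  | OOr C D => oext C x \/ oext D x
  | ONot C => ~ oext C x
  | OAll r C => forall y, orole_ext r x y -> oext C y
  | OEx r C => exists y, orole_ext r x y /\ oext C y
  | ONominal a => x = oind I a
  end.

Definition osat_inclusion (NC NR NI : Type) (I : ointerp NC NR NI)
    (i : inclusion (oconcept NC NR NI)) : Prop :=
  match i with Incl C D => forall x : odom I, oext C x -> oext D x end.

Definition osat_assertion (NC NR NI : Type) (I : ointerp NC NR NI)
    (f : oassertion NC NR NI) : Prop :=
  match f with
  | OInst C a => oext C (oind I a)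
  | ORel R a b => orname R (oind I a) (oind I b)
  end.

Definition osat_query (NC NR NI : Type) (I : ointerp NC NR NI)
    (F : oquery NC NR NI) : Prop :=
  match F with
  | OQIncl i => osat_inclusion I i
  | OQAssert f => osat_assertion I f
  end.

Definition ois_model (NC NR NI : Type) (I : ointerp NC NR NI)
    (K : okb NC NR NI) : Prop :=
  (forall i, otbox K i -> osat_inclusion I i) /\
  (forall f, oabox K f -> osat_assertion I f).

Definition oentails (NC NR NI : Type) (K : okb NC NR NI)
    (F : oquery NC NR NI) : Prop :=
  forall I : ointerp NC NR NI, ois_model I K -> osat_query I F.

Inductive trole (NR : Type) : Type :=
| OldRole (R : NR)
| ERole.

Arguments OldRole {NR} R.
Arguments ERole {NR}.

(* [EInd C] is e_C.  It is a name for every concept C, but only those for the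
   instances of membership axioms are used in the translation. *)
Inductive tind (NC NR NI : Type) : Type :=
| OldInd (a : NI)
| EInd (C : concept NC NR).

Arguments OldInd {NC NR NI} a.
Arguments EInd {NC NR NI} C.

Definition tconcept (NC NR NI : Type) : Type :=
  oconcept NC (trole NR) (tind NC NR NI).

Fixpoint trans (NC NR NI : Type) (C : concept NC NR) : tconcept NC NR NI :=
  match C with
  | CName A => OName A
  | CTop => OTop
  | CBot => OBot
  | CAnd C D => OAnd (trans NI C) (trans NI D)
  | COr C D => OOr (trans NI C) (trans NI D)
  | CNot C => ONot (trans NI C)
  | CDiff C D => OAnd (trans NI C) (ONot (trans NI D))
  | CPow C => OAll (ORole ERole) (trans NI C)
  | CAll R C => OAll (ORole (OldRole R)) (trans NI C)
  | CEx R C => OEx (ORole (OldRole R)) (trans NI C)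
  end.

(* The concepts C for which the name e_C is introduced. *)
Inductive mem_instance (NC NR NI : Type) (K : kb NC NR NI)
    (F : query NC NR NI) : concept NC NR -> Prop :=
| MI_mem C D : In (AMem C D) (abox K) -> mem_instance K F C
| MI_role_l C D R : In (ARoleMem C D R) (abox K) -> mem_instance K F C
| MI_role_r C D R : In (ARoleMem C D R) (abox K) -> mem_instance K F D
| MI_query C D : F = QMem C D -> mem_instance K F C.

Definition members_of_e (NC NR NI : Type) (C : concept NC NR) :
    tconcept NC NR NI :=
  OEx (OInv ERole) (ONominal (EInd C)).

Inductive trans_tbox (NC NR NI : Type) (K : kb NC NR NI)
    (F : query NC NR NI) : inclusion (tconcept NC NR NI) -> Prop :=
| TT_incl C D : In (Incl C D) (tbox K) ->
    trans_tbox K F (Incl (trans NI C) (trans NI D))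
| TT_eqv_l C : mem_instance K F C ->
    trans_tbox K F (Incl (trans NI C) (members_of_e NI C))
| TT_eqv_r C : mem_instance K F C ->
    trans_tbox K F (Incl (members_of_e NI C) (trans NI C)).

Inductive trans_abox (NC NR NI : Type) (K : kb NC NR NI) :
    oassertion NC (trole NR) (tind NC NR NI) -> Prop :=
| TA_mem C D : In (AMem C D) (abox K) ->
    trans_abox K (OInst (trans NI D) (EInd C))
| TA_role_mem C D R : In (ARoleMem C D R) (abox K) ->
    trans_abox K (ORel (OldRole R) (EInd C) (EInd D))
| TA_inst D a : In (AInst D a) (abox K) ->
    trans_abox K (OInst (trans NI D) (OldInd a))
| TA_role R a b : In (ARole R a b) (abox K) ->
    trans_abox K (ORel (OldRole R) (OldInd a) (OldInd b))
| TA_atom (a : NI) :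
    trans_abox K (OInst (ONot (OEx (ORole ERole) OTop)) (OldInd a)).

(* K^T depends on the query F through the names e_C. *)
Definition trans_kb (NC NR NI : Type) (K : kb NC NR NI)
    (F : query NC NR NI) : okb NC (trole NR) (tind NC NR NI) :=
  OKB (trans_tbox K F) (trans_abox K).

Definition trans_query (NC NR NI : Type) (F : query NC NR NI) :
    oquery NC (trole NR) (tind NC NR NI) :=
  match F with
  | QIncl C D => OQIncl (Incl (trans NI C) (trans NI D))
  | QInst C a => OQAssert (OInst (trans NI C) (OldInd a))
  | QMem C D => OQAssert (OInst (trans NI D) (EInd C))
  end.

(* Main.v *)
Require Import Defs.
From Stdlib Require Import List Classical ClassicalEpsilon.

Set Implicit Arguments.
Unset Strict Implicit.
Unset Printing Implicit Defensive.

(* A model of K^T is a graph whose edges [e y x] are read as "x is a member of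
   y".  Keeping its nodes as non-extensional, possibly non-well-founded
   urelements with these members, and closing them under extensional
   well-founded sets, gives an Omega-model in which the nodes form a transitive
   collection.  As Omega is not extensional, C^I may be chosen to be the node
   e_C whenever the translation introduces that name, and a well-founded set
   otherwise; both have the instances of C^T as members. *)

(** * Hereditary sets over a graph of urelements *)

Section HeredSets.

Variables (B : Type) (e : B -> B -> Prop).

(** Aczel's sets as well-founded trees, with urelements as additional leaves. *)
Inductive hset : Type :=
| Base (b : B)
| Sup (A : Type) (f : A -> hset).

(** Extensional on [Sup], but plain equality on urelements: nodes with the same members stay
    distinct, and no urelement is identified with a tree. *)
Fixpoint eqv (x y : hset) : Prop :=
  match x, y with
  | Base a, Base b => a = b
  | Sup f, Sup g =>
      (forall a, exists b, eqv (f a) (g b)) /\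
      (forall b, exists a, eqv (f a) (g b))
  | _, _ => False
  end.

Lemma eqv_refl x : eqv x x.
Proof. induction x as [b|A f IH]; simpl; eauto. Qed.

Lemma eqv_sym x y : eqv x y -> eqv y x.
Proof.
revert y; induction x as [b|A f IH]; intros [c|A' g]; simpl; auto.
intros [H1 H2]; split; intros a.
- destruct (H2 a) as [b Hb]; eauto.
- destruct (H1 a) as [b Hb]; eauto.
Qed.

Lemma eqv_trans x y z : eqv x y -> eqv y z -> eqv x z.
Proof.
revert y z; induction x as [b|A f IH]; intros [c|A' g] [d|A'' h]; simpl;
  try tauto; try congruence.
intros [H1 H2] [H3 H4]; split; intros a.
- destruct (H1 a) as [b Hb]; destruct (H3 b) as [c Hc]; eauto.
- destruct (H4 a) as [b Hb]; destruct (H2 b) as [c Hc]; eauto.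
Qed.

Lemma eqv_Base x b : eqv x (Base b) <-> x = Base b.
Proof.
destruct x; simpl; split; intros H; try easy; congruence.
Qed.

(** [idx] and [elt] present the members of both kinds of element as an indexed family, so that the
    operations below need no case analysis. *)
Definition idx (x : hset) : Type :=
  match x with Base b => {c | e b c} | @Sup A _ => A end.

Definition elt (x : hset) : idx x -> hset :=
  match x with Base b => fun c => Base (proj1_sig c) | Sup f => f end.

Definition hmem (x y : hset) : Prop := exists i, eqv x (elt (x := y) i).

Definition hsubs (x y : hset) : Prop := forall z, hmem z x -> hmem z y.

Lemma hmem_elt x i : hmem (elt (x := x) i) x.
Proof. exists i; apply eqv_refl. Qed.

Lemma hmem_eqv_l x x' y : eqv x x' -> hmem x y -> hmem x' y.
Proof.
intros H [i Hi]; exists i; eapply eqv_trans; [apply eqv_sym|]; eauto.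
Qed.

Lemma hmem_eqv_r x y y' : eqv y y' -> hmem x y -> hmem x y'.
Proof.
destruct y as [b|A f], y' as [b'|A' f']; simpl; try tauto.
- intros ->; trivial.
- intros [H _] [a Ha]; destruct (H a) as [a' Ha'].
  exists a'; eapply eqv_trans; eauto.
Qed.

Lemma hmem_Base x b : hmem x (Base b) <-> exists c, x = Base c /\ e b c.
Proof.
split.
- intros [[c Hc] H]; apply eqv_Base in H; exists c; auto.
- intros [c [-> Hc]]; exists (exist _ c Hc); apply eqv_refl.
Qed.

Definition hcup (x y : hset) : hset :=
  Sup (fun i : idx x + idx y =>
    match i with inl i => elt i | inr i => elt i end).

Definition hsep (x : hset) (P : idx x -> Prop) : hset :=
  Sup (fun i : {i | P i} => elt (proj1_sig i)).

Definition hminus (x y : hset) : hset :=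
  hsep (fun i : idx x => ~ hmem (elt i) y).

(* The urelements included in [x] are added separately, as no well-founded set
   is equivalent to them. *)
Definition hpow (x : hset) : hset :=
  Sup (fun s : (idx x -> Prop) + {b | hsubs (Base b) x} =>
    match s with inl P => hsep P | inr b => Base (proj1_sig b) end).

Lemma hcup_ax x y z : hmem x (hcup y z) <-> hmem x y \/ hmem x z.
Proof.
split.
- intros [[i|i] H]; [left|right]; exists i; exact H.
- intros [[i H]|[i H]]; [exists (inl i)|exists (inr i)]; exact H.
Qed.

Lemma hminus_ax x y z : hmem x (hminus y z) <-> hmem x y /\ ~ hmem x z.
Proof.
split.
- intros [[i Hi] H]; split; [exists i; exact H|].
  intros Hx; apply Hi; eapply hmem_eqv_l; eauto.
- intros [[i Hi] H]; unshelve eexists (exist _ i _); [|exact Hi].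
  intros H'; apply H; eapply hmem_eqv_l; [apply eqv_sym|]; eauto.
Qed.

Lemma hpow_ax x y : hmem x (hpow y) <-> hsubs x y.
Proof.
split.
- intros [[P|[b Hb]] H] z Hz; simpl in H; apply (hmem_eqv_r H) in Hz.
  + destruct Hz as [[i Hi] Hz]; exists i; exact Hz.
  + exact (Hb z Hz).
- destruct x as [b|A f]; intros H.
  + exists (inr (exist _ b H)); apply eqv_refl.
  (* A tree included in [y] is equivalent to the part of [y] separated by membership in that
     tree. *)
  + exists (inl (fun i => hmem (elt i) (Sup f))); simpl; split.
    * intros a; destruct (H (f a)) as [i Hi]; [exact (@hmem_elt (Sup f) a)|].
      unshelve eexists (exist _ i _); [|exact Hi].
      exists a; apply eqv_sym; exact Hi.
    * intros [i [a Ha]]; exists a; apply eqv_sym; exact Ha.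
Qed.

(** Kept transparent, since later proofs compute [mem] and [atom] in this model. *)
Definition hset_model (at_ : nat -> B)
    (at_inj : forall m n, at_ m = at_ n -> m = n)
    (at_empty : forall n b, ~ e (at_ n) b) : omega_model.
Proof.
apply (@OmegaModel hset hmem hsubs hcup hminus hpow) with
  (atom := fun n => Base (at_ n)).
- exact hcup_ax.
- exact hminus_ax.
- reflexivity.
- exact hpow_ax.
- intros m n H; apply at_inj; congruence.
- intros n x [[c Hc] _]; exact (at_empty n c Hc).
Defined.

End HeredSets.

(** * Lists and the individual names of a knowledge base *)

Lemma nodup_list (X : Type) (l : list X) :
  exists l', NoDup l' /\ forall x, In x l' <-> In x l.
Proof.
induction l as [|a l [l' [Hn Hl]]].
- exists nil; split; [constructor|tauto].
- destruct (classic (In a l')) as [Ha|Ha].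
  + exists l'; split; trivial; intros x; simpl; rewrite Hl; split; auto.
    intros [<-|Hx]; trivial; now apply Hl.
  + exists (a :: l'); split; [now constructor|].
    intros x; simpl; now rewrite Hl.
Qed.

Lemma hd_In (X : Type) (x : X) (l : list X) : l <> nil -> In (hd x l) l.
Proof. destruct l; [easy|now left]. Qed.

Lemma not_in_concept_ind (NC NR NI : Type) (a : NI) (C : concept NC NR) :
  ~ in_concept (NInd a) C.
Proof. induction C; simpl; try tauto; intuition discriminate. Qed.

Lemma kb_inds (NC NR NI : Type) (K : kb NC NR NI) :
  exists l : list NI, forall a, in_kb (NInd a) K -> In a l.
Proof.
exists (flat_map (fun f => match f with
  | AInst _ a => a :: nil
  | ARole _ a b => a :: b :: nil
  | _ => nil end) (abox K)).
intros a [[[C D] [_ H]]|[f [Hf H]]].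
- destruct H as [H|H]; now apply not_in_concept_ind in H.
- apply in_flat_map; exists f; split; trivial.
  destruct f; simpl in *; intuition (try discriminate);
    try (now exfalso; eapply not_in_concept_ind; eauto);
    match goal with H : NInd _ = NInd _ |- _ => injection H end; auto.
Qed.

(** * From a model of the translation to a model of the knowledge base *)

Section Completeness.

Variables (NC NR NI : Type) (K : kb NC NR NI) (F : query NC NR NI).
Variable J : ointerp NC (trole NR) (tind NC NR NI).
Hypothesis HJ : ois_model J (trans_kb K F).

Let eJ := orname (o := J) ERole.

Lemma members_of_eE C d :
  oext (members_of_e NI C) d <-> eJ (oind J (EInd C)) d.
Proof.
split; [intros [y [Hy ->]]; exact Hy|].
intros H; exists (oind J (EInd C)); split; [exact H|reflexivity].
Qed.

(** This is the content of the two inclusions between [C^T] and [members_of_e]; it allows the node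
    of [EInd C] to serve as the extension of [C]. *)
Lemma trans_instance C d : mem_instance K F C ->
  eJ (oind J (EInd C)) d <-> oext (trans NI C) d.
Proof.
intros HC; rewrite <- members_of_eE; split; revert d.
- exact (proj1 HJ _ (TT_eqv_r HC)).
- exact (proj1 HJ _ (TT_eqv_l HC)).
Qed.

Lemma ind_no_members a d : ~ eJ (oind J (OldInd a)) d.
Proof.
intros H; apply (proj2 HJ _ (TA_atom K a)); exists d; split; [exact H|exact I].
Qed.

(* Only finitely many individual names occur in [K], so countably many atoms
   suffice; all other names are sent to the head of [l]. *)
Lemma atom_nodes : exists l : list (odom J),
  NoDup l /\ (forall d, In d l -> forall d', ~ eJ d d') /\
  (forall a, in_kb (NInd a) K -> In (oind J (OldInd a)) l) /\
  (inhabited NI -> l <> nil).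
Proof.
destruct (kb_inds K) as [L HL].
(* [K] may mention no individual although [NI] is inhabited; one extra name then keeps the list
   nonempty. *)
assert (exists L', (forall a, In a L -> In a L') /\
  (inhabited NI -> L' <> nil)) as [L' [HL' HI]].
{ destruct (classic (inhabited NI)) as [[a]|Hn].
  - exists (a :: L); split; [now right|discriminate].
  - exists L; tauto. }
(* Different names may denote the same node, whereas the enumeration of atoms must be injective. *)
destruct (nodup_list (map (fun a => oind J (OldInd a)) L')) as [l [Hn Hl]].
exists l; repeat split; trivial.
- intros d Hd; apply Hl, in_map_iff in Hd; destruct Hd as [a [<- _]].
  apply ind_no_members.
- intros a Ha; apply Hl, (in_map (fun a => oind J (OldInd a))); auto.
- intros Hi ->; apply (HI Hi); destruct L' as [|a L']; trivial.
  destruct (proj2 (Hl (oind J (OldInd a)))); now left.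
Qed.

Variable l : list (odom J).
Hypothesis l_nodup : NoDup l.
Hypothesis l_empty : forall d, In d l -> forall d', ~ eJ d d'.
Hypothesis l_named : forall a, in_kb (NInd a) K -> In (oind J (OldInd a)) l.
Hypothesis l_nonnil : inhabited NI -> l <> nil.

(** The summand [nat] supplies isolated, memberless urelements, so that there are infinitely many
    atoms even when [J] is finite. *)
Let node : Type := (odom J + nat)%type.

Let edge (x y : node) : Prop :=
  match x, y with inl c, inl d => eJ c d | _, _ => False end.

Let node_atom (n : nat) : node :=
  match nth_error l n with Some d => inl d | None => inr n end.

Lemma node_atom_inj m n : node_atom m = node_atom n -> m = n.
Proof.
unfold node_atom.
destruct (nth_error l m) eqn:Hm, (nth_error l n) eqn:Hn; intros H;
  try congruence.
apply (proj1 (NoDup_nth_error l) l_nodup); [|congruence].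
apply nth_error_Some; congruence.
Qed.

Lemma node_atom_empty n b : ~ edge (node_atom n) b.
Proof.
unfold node_atom; destruct (nth_error l n) eqn:Hn; [|now destruct b].
destruct b as [d|k]; simpl; [|tauto].
apply l_empty; eapply nth_error_In; eauto.
Qed.

Let M : omega_model := hset_model node_atom_inj node_atom_empty.

Let pt (d : odom J) : M := Base (inl d : node).

Lemma pt_inj c d : pt c = pt d -> c = d.
Proof. intros H; unfold pt in H; congruence. Qed.

Lemma mem_pt (x : M) d : mem x (pt d) <-> exists c, x = pt c /\ eJ d c.
Proof.
split.
- intros H; apply hmem_Base in H.
  destruct H as [[c|n] [-> Hc]]; [exists c; auto|easy].
- intros [c [-> Hc]]; apply hmem_Base; exists (inl c); auto.
Qed.

Let cext (C : concept NC NR) : M :=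
  if excluded_middle_informative (mem_instance K F C)
  then pt (oind J (EInd C))
  else Sup (fun d : {d | oext (trans NI C) d} => pt (proj1_sig d)).

(** For an instance this is [trans_instance], otherwise it holds by construction. Members are equal
    to nodes, not just equivalent to them, because [eqv] to a urelement is equality. *)
Lemma mem_cext C (x : M) :
  mem x (cext C) <-> exists d, x = pt d /\ oext (trans NI C) d.
Proof.
unfold cext; destruct (excluded_middle_informative _) as [HC|HC].
- rewrite mem_pt; split; intros [d [-> Hd]]; exists d; split; trivial;
    now apply (trans_instance d HC).
- split.
  + intros [[d Hd] H]; apply eqv_Base in H; exists d; auto.
  + intros [d [-> Hd]]; exists (exist _ d Hd); apply eqv_refl.
Qed.

Lemma mem_cext_pt C d : mem (pt d) (cext C) <-> oext (trans NI C) d.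
Proof.
rewrite mem_cext; split; [intros [c [H Hc]]|eauto].
now apply pt_inj in H; subst.
Qed.

Lemma cext_instance C : mem_instance K F C -> cext C = pt (oind J (EInd C)).
Proof.
unfold cext; now destruct (excluded_middle_informative _).
Qed.

Let mrole (R : NR) (x y : M) : Prop :=
  exists c d, x = pt c /\ y = pt d /\ orname (o := J) (OldRole R) c d.

Lemma mrole_pt R c d : mrole R (pt c) (pt d) <-> orname (OldRole R) c d.
Proof.
split; [|intros H; exists c, d; auto].
now intros [c' [d' [->%pt_inj [->%pt_inj H]]]].
Qed.

Let mind (a : NI) : M :=
  if excluded_middle_informative (In (oind J (OldInd a)) l)
  then pt (oind J (OldInd a))
  else pt (hd (oind J (OldInd a)) l).

Lemma mind_named a : in_kb (NInd a) K -> mind a = pt (oind J (OldInd a)).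
Proof.
intros H; apply l_named in H.
unfold mind; now destruct (excluded_middle_informative _).
Qed.

Lemma pt_atom d : In d l -> exists n, pt d = atom n.
Proof.
intros H; apply In_nth_error in H; destruct H as [n Hn]; exists n.
simpl; unfold node_atom; now rewrite Hn.
Qed.

(** The domain has to be [cext CTop] itself: [ext_top] is an equality, and [CTop] may be an instance
    of a membership axiom. It is transitive because members of nodes of [J] are again such nodes. *)
Definition model_interp : interp NC NR NI.
Proof.
unshelve eapply (@Interp NC NR NI M (cext CTop) _ _
  (fun A => cext (CName A)) _ mrole _ mind _).
- destruct (odom_nonempty J) as [d]; exists (pt d); now apply mem_cext_pt.
- intros y [d [-> _]]%mem_cext; apply subs_ax.
  intros z [c [-> _]]%mem_pt; now apply mem_cext_pt.
- intros A; apply subs_ax; intros x [d [-> _]]%mem_cext; now apply mem_cext_pt.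
- intros R x y [c [d [-> [-> _]]]]; now rewrite !mem_cext_pt.
- intros a.
  assert (exists d, In d l /\ mind a = pt d) as [d [Hd ->]].
  (* Here [a] shows that [NI] is inhabited, so [l] is nonempty and the default of [hd] is not
     reached. *)
  { unfold mind; destruct (excluded_middle_informative _) as [H|_]; eauto.
    eexists; split; [|reflexivity].
    now apply hd_In, l_nonnil. }
  split; [now apply pt_atom|now apply mem_cext_pt].
Defined.

Lemma model_extension : is_extension (I := model_interp) cext.
Proof.
split; simpl.
- reflexivity.
- reflexivity.
- intros x H; apply (mem_cext CBot) in H; now destruct H as [d [_ []]].
(* [simpl] has unfolded [mem]; it is folded back for rewriting. *)
- intros C D x; change (hmem edge) with (@mem M); rewrite !mem_cext.
  split; [intros [d [-> [H1 H2]]]; split; exists d; auto|].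
  intros [[d [-> H1]] [c [->%pt_inj H2]]]; exists c; simpl; auto.
- intros C D x; rewrite hcup_ax; change (hmem edge) with (@mem M).
  rewrite !mem_cext; split; [intros [d [-> [H|H]]]; eauto|].
  intros [[d [-> H]]|[d [-> H]]]; exists d; simpl; auto.
- intros C x; rewrite hminus_ax; change (hmem edge) with (@mem M).
  rewrite !(mem_cext _ x); split.
  + intros [d [-> H]]; split; [now exists d|].
    intros [c [->%pt_inj Hc]]; now apply H.
  + intros [[d [-> _]] H]; exists d; split; trivial; intros Hd; apply H; eauto.
- intros C D x; rewrite hminus_ax; change (hmem edge) with (@mem M).
  rewrite !mem_cext; split.
  + intros [d [-> [H1 H2]]]; split; [now exists d|].
    intros [c [->%pt_inj Hc]]; now apply H2.
  + intros [[d [-> H1]] H]; exists d; split; trivial.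
    split; trivial; intros Hd; apply H; eauto.
(* The members of a node are its [e]-successors, so its inclusion in the extension of [C] is the
   semantics of [OAll]. Intersecting with the domain discards the subsets that are not nodes of
   [J]. *)
- intros C x; rewrite hpow_ax; unfold hsubs.
  change (hmem edge) with (@mem M).
  rewrite (mem_cext (CPow C)), (mem_cext CTop); split.
  + intros [d [-> H]]; split; [|now exists d].
    intros z [c [-> Hc]]%mem_pt; apply mem_cext_pt; exact (H c Hc).
  + intros [H [d [-> _]]]; exists d; split; trivial.
    intros c Hc; apply mem_cext_pt, H, mem_pt; eauto.
- intros R C x; change (hmem edge) with (@mem M).
  rewrite (mem_cext (CAll R C)), (mem_cext CTop); split.
  + intros [d [-> H]]; split; [now exists d|].
    intros y [d' [c [->%pt_inj [-> Hc]]]]; apply mem_cext_pt; exact (H c Hc).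
  + intros [[d [-> _]] H]; exists d; split; trivial.
    intros c Hc; apply mem_cext_pt, H, mrole_pt; exact Hc.
- intros R C x; change (hmem edge) with (@mem M).
  rewrite (mem_cext (CEx R C)), (mem_cext CTop); split.
  + intros [d [-> [c [Hc H]]]]; split; [now exists d|].
    exists (pt c); split; [now apply mrole_pt|now apply mem_cext_pt].
  + intros [[d [-> _]] [y [[d' [c [<-%pt_inj [-> Hc]]]] H]]].
    exists d; split; trivial; exists c; split; [exact Hc|].
    now apply mem_cext_pt.
Qed.

Lemma subs_cext C D : subs (cext C) (cext D) <->
  osat_inclusion J (Incl (trans NI C) (trans NI D)).
Proof.
rewrite subs_ax; split.
- intros H d Hd; apply mem_cext_pt, H, mem_cext_pt, Hd.
- intros H x [d [-> Hd]]%mem_cext; apply mem_cext_pt, H, Hd.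
Qed.

(** In a membership axiom the extension of the instance is the node of its [EInd] name, so the axiom
    is exactly the translated assertion about that node. *)
Lemma model_is_model : is_model (I := model_interp) cext K.
Proof.
split.
- intros [C D] H; apply subs_cext; exact (proj1 HJ _ (TT_incl F H)).
- intros f Hf.
  assert (Hk : forall s, in_assertion s f -> in_kb s K)
    by (intros s Hs; right; eauto).
  destruct f as [C a|R a b|C D|C D R]; simpl in *.
  + rewrite mind_named by auto.
    apply mem_cext_pt; exact (proj2 HJ _ (TA_inst Hf)).
  + rewrite !mind_named by auto.
    apply mrole_pt; exact (proj2 HJ _ (TA_role Hf)).
  + rewrite (@cext_instance C) by exact (MI_mem F Hf).
    apply mem_cext_pt; exact (proj2 HJ _ (TA_mem Hf)).
  + rewrite (@cext_instance C) by exact (MI_role_l F Hf).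
    rewrite (@cext_instance D) by exact (MI_role_r F Hf).
    apply mrole_pt; exact (proj2 HJ _ (TA_role_mem Hf)).
Qed.

Lemma model_reflects_query : query_over K F ->
  sat_query (I := model_interp) cext F -> osat_query J (trans_query F).
Proof.
intros hF.
(* The model depends on [F] through [mem_instance], so the case analysis is made on a copy [G]. *)
enough (HG : forall G, F = G -> sat_query (I := model_interp) cext G ->
  osat_query J (trans_query G)) by exact (HG F eq_refl).
intros [C D|C a|C D] HF; simpl.
- apply subs_cext.
- rewrite mind_named by (apply hF; rewrite HF; simpl; auto); apply mem_cext_pt.
- rewrite (cext_instance (MI_query K HF)); apply mem_cext_pt.
Qed.

End Completeness.

Theorem proposition3 (NC NR NI : Type) (K : kb NC NR NI) (F : query NC NR NI)
  (hF : query_over K F) :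
  entails K F -> oentails (trans_kb K F) (trans_query F).
Proof.
intros H J HJ.
destruct (atom_nodes HJ) as [l [Hn [He [Hk Hi]]]].
apply (model_reflects_query (HJ := HJ) (l_nodup := Hn) (l_empty := He) Hk
  (l_nonnil := Hi) hF), H.
- apply model_extension.
- apply model_is_model, Hk.
Qed.
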